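(* An element $A\in \mathrm{SL}(3,\mathbb{H})$ satisfies $gAg^{-1}=-A^{-1}$ for some $g\in \mathrm{SL}(3,\mathbb{H})$ if and only if it is conjugate in $\mathrm{SL}(3,\mathbb{H})$ to one of the following matrices: (i) $\begin{pmatrix} e^{\mathbf{i}\theta}&0&0\\0&-e^{-\mathbf{i}\theta}&0\\0&0&\mathbf{i}\end{pmatrix}$, where $\theta\in[0,\pi]$; (ii) $\begin{pmatrix} re^{\mathbf{i}\theta}&0&0\\0&-r^{-1}e^{-\mathbf{i}\theta}&0\\0&0&\mathbf{i}\end{pmatrix}$, where $r\in\mathbb{R}$, $r>0$, $r\neq 1$, and $\theta\in[0,\pi]$; (iii) $\begin{pmatrix} \mathbf{i}&1&0\\0&\mathbf{i}&0\\0&0&\mathbf{i}\end{pmatrix}$; (iv) $\begin{pmatrix} \mathbf{i}&1&0\\0&\mathbf{i}&1\\0&0&\mathbf{i}\end{pmatrix}$.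
   Context: $\mathbb{H}$ denotes Hamilton's real quaternions with units $\mathbf{i},\mathbf{j},\mathbf{k}$, and $\mathbb{C}=\mathbb{R}+\mathbb{R}\mathbf{i}\subset\mathbb{H}$. For $A\in \mathrm{M}(3,\mathbb{H})$ write $A=A_1+A_2\mathbf{j}$ with $A_1,A_2\in \mathrm{M}(3,\mathbb{C})$, and put $\det_{\mathbb{H}}(A):=\det\begin{pmatrix} A_1 & A_2\\ -\overline{A_2} & \overline{A_1}\end{pmatrix}$. Put $\mathrm{SL}(3,\mathbb{H})=\{g\in \mathrm{M}(3,\mathbb{H}) : \det_{\mathbb{H}}(g)=1\}$. *)

(* Defs.v *)
From HB Require Import structures.
From mathcomp Require Import all_boot all_order all_algebra.
From mathcomp Require Export complex.
From mathcomp Require Import all_classical all_reals all_analysis.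
From mathcomp Require Import ring.

Set Implicit Arguments.
Unset Strict Implicit.
Unset Printing Implicit Defensive.

Import GRing.Theory.
Local Open Scope ring_scope.

(* Quat a b c d stands for a + b i + c j + d k *)
Record quat (R : Type) : Type := Quat { qre : R; qim_i : R; qim_j : R; qim_k : R }.

Section QuatChoice.
Variable R : Type.
Definition prod_of_quat (x : quat R) : R * R * R * R :=
  let: Quat a b c d := x in (a, b, c, d).
Definition quat_of_prod (p : R * R * R * R) : quat R :=
  let: (a, b, c, d) := p in Quat a b c d.
Lemma prod_of_quatK : cancel prod_of_quat quat_of_prod.
Proof. by case. Qed.
End QuatChoice.

HB.instance Definition _ (R : eqType) := Equality.copy (quat R)
  (can_type (@prod_of_quatK R)).
HB.instance Definition _ (R : choiceType) := Choice.copy (quat R)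
  (can_type (@prod_of_quatK R)).

Section QuatRing.
Variable R : comNzRingType.
Implicit Types (r : R) (x y z : quat R).

Definition addq x y :=
  let: Quat a b c d := x in let: Quat a' b' c' d' := y in
  Quat (a + a') (b + b') (c + c') (d + d').

Definition oppq x := let: Quat a b c d := x in Quat (- a) (- b) (- c) (- d).

Definition mulq x y :=
  let: Quat a b c d := x in let: Quat a' b' c' d' := y in
  Quat (a * a' - b * b' - c * c' - d * d')
       (a * b' + b * a' + c * d' - d * c')
       (a * c' - b * d' + c * a' + d * b')
       (a * d' + b * c' - c * b' + d * a').

Definition scaleq r x :=
  let: Quat a b c d := x in Quat (r * a) (r * b) (r * c) (r * d).

Fact addqA : associative addq.
Proof. by move=> [????] [????] [????] /=; rewrite !addrA. Qed.
Fact addqC : commutative addq.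
Proof. by move=> [????] [????] /=; congr Quat; rewrite addrC. Qed.
Fact add0q : left_id (Quat 0 0 0 0) addq.
Proof. by move=> [????] /=; rewrite !add0r. Qed.
Fact addNq : left_inverse (Quat 0 0 0 0) oppq addq.
Proof. by move=> [????] /=; rewrite !addNr. Qed.

HB.instance Definition _ := GRing.isZmodule.Build (quat R) addqA addqC add0q addNq.

Fact mulqA : associative mulq.
Proof. by move=> [????] [????] [????] /=; congr Quat; ring. Qed.
Fact mul1q : left_id (Quat 1 0 0 0) mulq.
Proof. by move=> [????] /=; congr Quat; ring. Qed.
Fact mulq1 : right_id (Quat 1 0 0 0) mulq.
Proof. by move=> [????] /=; congr Quat; ring. Qed.
Fact mulqDl : left_distributive mulq addq.
Proof. by move=> [????] [????] [????] /=; congr Quat; ring. Qed.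
Fact mulqDr : right_distributive mulq addq.
Proof. by move=> [????] [????] [????] /=; congr Quat; ring. Qed.
Fact oneq_neq0 : Quat 1 0 0 0 != 0 :> quat R.
Proof. by apply/eqP => -[] /eqP; rewrite oner_eq0. Qed.

HB.instance Definition _ := GRing.Zmodule_isNzRing.Build (quat R)
  mulqA mul1q mulq1 mulqDl mulqDr oneq_neq0.

Fact scaleqA r s x : scaleq r (scaleq s x) = scaleq (r * s) x.
Proof. by case: x => * /=; rewrite !mulrA. Qed.
Fact scale1q : left_id 1 scaleq.
Proof. by move=> [????] /=; rewrite !mul1r. Qed.
Fact scaleqDr : right_distributive scaleq +%R.
Proof. by move=> r [????] [????]; congr Quat; rewrite mulrDr. Qed.
Fact scaleqDl x : {morph scaleq^~ x : r s / r + s >-> r + s}.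
Proof. by case: x => ???? r s; congr Quat; rewrite mulrDl. Qed.

HB.instance Definition _ := GRing.Zmodule_isLmodule.Build R (quat R)
  scaleqA scale1q scaleqDr scaleqDl.

Definition qi : quat R := Quat 0 1 0 0.
Definition qj : quat R := Quat 0 0 1 0.
Definition qk : quat R := Quat 0 0 0 1.

Lemma quatE a b c d :
  Quat a b c d = a *: (1 : quat R) + b *: qi + c *: qj + d *: qk.
Proof. by congr Quat; ring. Qed.

Lemma quat_units :
  [/\ qi * qi = -1, qj * qj = -1, qk * qk = -1 & qi * qj * qk = -1].
Proof. by split; congr Quat; ring. Qed.

End QuatRing.
Arguments qi {R}.
Arguments qj {R}.
Arguments qk {R}.

Section QuatDet.
Variable R : rcfType.
Local Notation H := (quat R).
Local Notation C := R[i].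

Definition quat_of_complex (z : C) : H := Quat (complex.Re z) (complex.Im z) 0 0.

Definition qpart1 (x : H) : C := Complex (qre x) (qim_i x).
Definition qpart2 (x : H) : C := Complex (qim_j x) (qim_k x).

Lemma qpartE x : x = quat_of_complex (qpart1 x) + quat_of_complex (qpart2 x) * qj.
Proof. by case: x => a b c d; congr Quat => /=; ring. Qed.

Lemma qpart1M x y :
  qpart1 (x * y) = qpart1 x * qpart1 y - qpart2 x * conjc (qpart2 y).
Proof. by case: x y => [????] [????]; congr Complex => /=; ring. Qed.

Lemma qpart2M x y :
  qpart2 (x * y) = qpart1 x * qpart2 y + qpart2 x * conjc (qpart1 y).
Proof. by case: x y => [????] [????]; congr Complex => /=; ring. Qed.

Fact qpart1_is_additive : zmod_morphism qpart1.
Proof. by move=> [????] [????]. Qed.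
HB.instance Definition _ := GRing.isZmodMorphism.Build H C qpart1 qpart1_is_additive.
Fact qpart2_is_additive : zmod_morphism qpart2.
Proof. by move=> [????] [????]. Qed.
HB.instance Definition _ := GRing.isZmodMorphism.Build H C qpart2 qpart2_is_additive.

Section Dim.
Variable n : nat.
Implicit Types A B : 'M[H]_n.

Definition mxpart1 A : 'M[C]_n := map_mx qpart1 A.
Definition mxpart2 A : 'M[C]_n := map_mx qpart2 A.

Definition mx_of_parts (A1 A2 : 'M[C]_n) : 'M[H]_n :=
  map_mx quat_of_complex A1 + map_mx (fun z => quat_of_complex z * qj) A2.

Lemma mx_of_partsK A : mx_of_parts (mxpart1 A) (mxpart2 A) = A.
Proof. by apply/matrixP => i j; rewrite !mxE -qpartE. Qed.

Definition complexify A : 'M[C]_(n + n) :=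
  block_mx (mxpart1 A) (mxpart2 A)
           (- map_mx conjc (mxpart2 A)) (map_mx conjc (mxpart1 A)).

Definition detH A : C := \det (complexify A).

Lemma mxpart1M A B : mxpart1 (A *m B) =
  mxpart1 A *m mxpart1 B - mxpart2 A *m map_mx conjc (mxpart2 B).
Proof.
apply/matrixP => i j; rewrite !mxE raddf_sum -sumrB.
by apply: eq_bigr => k _; rewrite !mxE -qpart1M.
Qed.

Lemma mxpart2M A B : mxpart2 (A *m B) =
  mxpart1 A *m mxpart2 B + mxpart2 A *m map_mx conjc (mxpart1 B).
Proof.
apply/matrixP => i j; rewrite !mxE raddf_sum -big_split /=.
by apply: eq_bigr => k _; rewrite !mxE -qpart2M.
Qed.

Lemma conjmxK m p (X : 'M[C]_(m, p)) : map_mx conjc (map_mx conjc X) = X.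
Proof. by apply/matrixP => i j; rewrite !mxE conjcK. Qed.

Lemma complexifyM A B : complexify (A *m B) = complexify A *m complexify B.
Proof.
rewrite /complexify mulmx_block mxpart1M mxpart2M.
rewrite map_mxD map_mxB !map_mxM !conjmxK !mulmxN !mulNmx.
by congr block_mx; rewrite ?opprD 1?addrC.
Qed.

Lemma complexify1 : complexify 1%:M = 1%:M.
Proof.
rewrite /complexify.
have -> : mxpart1 1%:M = 1%:M.
  by apply/matrixP => i j; rewrite !mxE; case: eqP.
have -> : mxpart2 1%:M = 0.
  by apply/matrixP => i j; rewrite !mxE; case: eqP.
by rewrite !map_mx0 oppr0 map_mx1 -scalar_mx_block.
Qed.

Lemma complexify_inj : injective complexify.
Proof.
by move=> A B /eq_block_mx[e1 e2 _ _]; rewrite -[A]mx_of_partsK e1 e2 mx_of_partsK.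
Qed.

Lemma detHM A B : detH (A *m B) = detH A * detH B.
Proof. by rewrite /detH complexifyM det_mulmx. Qed.

Lemma detH1 : detH 1%:M = 1.
Proof. by rewrite /detH complexify1 det1. Qed.

Definition invHmx A : 'M[H]_n :=
  let X := invmx (complexify A) in mx_of_parts (ulsubmx X) (ursubmx X).

(* X is some complexify A iff J *m X = conj X *m J *)
Let J : 'M[C]_(n + n) := block_mx 0 1%:M (- 1%:M) 0.

Lemma complexifyJ A : J *m complexify A = map_mx conjc (complexify A) *m J.
Proof.
rewrite /complexify /J map_block_mx !mulmx_block map_mxN !conjmxK.
by rewrite !mul0mx !mul1mx !mulNmx !mul1mx !mulmx0 !mulmxN !mulmx1
  ?mulNmx ?opprK ?oppr0 ?add0r ?addr0.
Qed.

Lemma mx_of_parts1 (X Y : 'M[C]_n) : mxpart1 (mx_of_parts X Y) = X.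
Proof.
apply/matrixP => i j; rewrite !mxE raddfD /=.
by case: (X i j) (Y i j) => [??] [??]; congr Complex => /=; ring.
Qed.

Lemma mx_of_parts2 (X Y : 'M[C]_n) : mxpart2 (mx_of_parts X Y) = Y.
Proof.
apply/matrixP => i j; rewrite !mxE raddfD /=.
by case: (X i j) (Y i j) => [??] [??]; congr Complex => /=; ring.
Qed.

Lemma complexify_invHmx A : detH A = 1 -> complexify (invHmx A) = invmx (complexify A).
Proof.
move=> dA; have uX : complexify A \in unitmx by rewrite unitmxE -/(detH A) dA unitr1.
set X := complexify A in uX *.
have ucX : map_mx conjc X \in unitmx by rewrite map_unitmx.
have eJ : J *m invmx X = map_mx conjc (invmx X) *m J.
  rewrite map_invmx; apply: (can_inj (mulKmx ucX)).
  by rewrite mulKVmx // mulmxA -complexifyJ mulmxK.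
rewrite /complexify /invHmx -/X mx_of_parts1 mx_of_parts2.
move: eJ; set Y := invmx X; rewrite -{1 2}[Y]submxK /J map_block_mx !mulmx_block.
rewrite !mul0mx !mul1mx !mulmx0 !mulmxN !mulmx1 ?add0r ?addr0.
by move=> /eq_block_mx[e1 e2 _ _]; rewrite -[RHS]submxK e1 e2.
Qed.

Lemma mulVHmx A : detH A = 1 -> invHmx A *m A = 1%:M.
Proof.
move=> dA; apply: complexify_inj; rewrite complexifyM complexify1 complexify_invHmx //.
by rewrite mulVmx // unitmxE -/(detH A) dA unitr1.
Qed.

Lemma mulHmxV A : detH A = 1 -> A *m invHmx A = 1%:M.
Proof.
move=> dA; apply: complexify_inj; rewrite complexifyM complexify1 complexify_invHmx //.
by rewrite mulmxV // unitmxE -/(detH A) dA unitr1.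
Qed.

Lemma detHV A : detH A = 1 -> detH (invHmx A) = 1.
Proof. by move=> dA; rewrite -(mul1r (detH _)) -{1}dA -detHM mulHmxV // detH1. Qed.

End Dim.
End QuatDet.

Record SLH (R : rcfType) (n : nat) : Type :=
  MkSLH { SLmx : 'M[quat R]_n; _ : detH SLmx == 1 }.

HB.instance Definition _ R n := [isSub for @SLmx R n].
HB.instance Definition _ R n := [Choice of SLH R n by <:].

Section SLHGroup.
Variables (R : rcfType) (n : nat).
Local Notation SL := (SLH R n).
Implicit Types A B : SL.

Fact SLH_det A : detH (SLmx A) = 1.
Proof. by case: A => M dM; apply/eqP. Qed.

Fact SLH_one_subproof : detH (1%:M : 'M[quat R]_n) == 1.
Proof. by rewrite detH1. Qed.
Fact SLH_mul_subproof A B : detH (SLmx A *m SLmx B) == 1.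
Proof. by rewrite detHM !SLH_det mulr1. Qed.
Fact SLH_inv_subproof A : detH (invHmx (SLmx A)) == 1.
Proof. by rewrite detHV ?SLH_det. Qed.

Definition SLH_one : SL := MkSLH SLH_one_subproof.
Definition SLH_mul A B : SL := MkSLH (SLH_mul_subproof A B).
Definition SLH_inv A : SL := MkSLH (SLH_inv_subproof A).

Fact SLH_mulA : associative SLH_mul.
Proof. by move=> A B D; apply: val_inj; rewrite /= mulmxA. Qed.
Fact SLH_mul1 : left_id SLH_one SLH_mul.
Proof. by move=> A; apply: val_inj; rewrite /= mul1mx. Qed.
Fact SLH_mulr1 : right_id SLH_one SLH_mul.
Proof. by move=> A; apply: val_inj; rewrite /= mulmx1. Qed.
Fact SLH_mulV : left_inverse SLH_one SLH_inv SLH_mul.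
Proof. by move=> A; apply: val_inj; rewrite /= mulVHmx ?SLH_det. Qed.
Fact SLH_mulrV : right_inverse SLH_one SLH_inv SLH_mul.
Proof. by move=> A; apply: val_inj; rewrite /= mulHmxV ?SLH_det. Qed.

HB.instance Definition _ := isGroup.Build SL
  SLH_mulA SLH_mul1 SLH_mulr1 SLH_mulV SLH_mulrV.

Definition SLH_conjugate A (M : 'M[quat R]_n) : Prop :=
  exists g : SL, SLmx (g * A * g^-1)%g = M.

End SLHGroup.

Definition qexpi (R : realType) (t : R) : quat R := Quat (cos t) (sin t) 0 0.

Definition mx3 (R : rcfType) (s : seq (seq (quat R))) : 'M[quat R]_3 :=
  \matrix_(i, j) nth 0 (nth [::] s i) j.

(* Main.v *)
Require Import Defs.
From HB Require Import structures.
From mathcomp Require Import all_boot all_order all_fingroup all_algebra.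
From mathcomp Require Import all_classical all_reals all_analysis.
From mathcomp Require Import spectral ring lra.

Set Implicit Arguments.
Unset Strict Implicit.
Unset Printing Implicit Defensive.

Import Order.TTheory GRing.Theory Num.Theory.
Local Open Scope ring_scope.

(* Put [c(z) = - z^-1].  Every quaternionic matrix is similar to a triangular one with
   complex diagonal entries [l_i], each of which is determined up to conjugation, and
   [det (complexify A - m) = prod_i (l_i - m) (conj l_i - m)].  At [m = 0] this shows
   [detH A >= 0], so any invertible conjugating matrix rescales into SL.  If [A] is
   similar to [- A^-1], comparing this polynomial at [m] and at [- m^-1] shows that
   the classes of the [l_i] are permuted by [c], whose only fixed class is that of
   [i]: either all [l_i] are similar to [i], or the classes are [l], [c(l)] and [i],
   pairwise distinct.  In the second case Sylvester's equation diagonalizes [A]; in the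
   first one the off-diagonal entries can be made complex, and the nilpotent part is
   reduced by hand.  Conversely each normal form [M] satisfies [M P M = - P] for an
   explicit involution [P]. *)

(** * Similarity and reversibility in a ring *)

Definition sim (S : pzRingType) (a b : S) : Prop :=
  exists p q : S, [/\ p * q = 1, q * p = 1 & p * a = b * p].

(** For invertible [a] this is [p a p^-1 = - a^-1] cleared of inverses; in this form [p] may be
    multiplied by a central unit. *)
Definition reversible (S : pzRingType) (a : S) : Prop :=
  exists p q : S, [/\ p * q = 1, q * p = 1 & a * p * a = - p].

Lemma sim_refl (S : pzRingType) (a : S) : sim a a.
Proof. by exists 1, 1; rewrite !mulr1 mul1r. Qed.

Lemma sim_trans (S : pzRingType) (b a c : S) : sim a b -> sim b c -> sim a c.
Proof.
case=> p [q [pq qp pa]] [r [s [rs sr rb]]]; exists (r * p), (q * s); split.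
- by rewrite mulrA -[r * p * q]mulrA pq mulr1.
- by rewrite mulrA -[q * s * r]mulrA sr mulr1.
- by rewrite -mulrA pa mulrA rb mulrA.
Qed.

Lemma reversible_sim (S : pzRingType) (a b : S) :
  sim a b -> reversible b -> reversible a.
Proof.
case=> p [q [pq qp pa]] [r [s [rs sr brb]]].
have -> : a = q * b * p by rewrite -mulrA -pa mulrA qp mul1r.
exists (q * r * p), (q * s * p); split.
- by rewrite !mulrA -[q * r * p * q]mulrA pq mulr1 -[q * r * s]mulrA rs mulr1.
- by rewrite !mulrA -[q * s * p * q]mulrA pq mulr1 -[q * s * r]mulrA sr mulr1.
- rewrite !mulrA -[q * b * p * q]mulrA pq mulr1 -[q * b * r * p * q]mulrA pq mulr1.
  by rewrite -[q * b * r]mulrA -[q * (b * r) * b]mulrA brb mulrN mulNr.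
Qed.

(** * Inverses of quaternions and similarity classes of complex numbers *)

Lemma quat_unitP (R : rcfType) (x : quat R) :
  x != 0 -> exists y, x * y = 1 /\ y * x = 1.
Proof.
case: x => a b c d x0; pose n := a ^+ 2 + b ^+ 2 + c ^+ 2 + d ^+ 2.
have n0 : n != 0.
  apply: contraNneq x0 => n0; have n0' := n0; rewrite /n in n0'.
  have [[[ha hb] hc] hd] := (sqr_ge0 a, sqr_ge0 b, sqr_ge0 c, sqr_ge0 d).
  have [ea eb ec ed] : [/\ a ^+ 2 = 0, b ^+ 2 = 0, c ^+ 2 = 0 & d ^+ 2 = 0].
    by split; lra.
  move/eqP: ea eb ec ed; rewrite sqrf_eq0 => /eqP -> /eqP; rewrite sqrf_eq0.
  move=> /eqP -> /eqP; rewrite sqrf_eq0 => /eqP -> /eqP; rewrite sqrf_eq0.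
  by move=> /eqP ->.
by exists (Quat (a / n) (- b / n) (- c / n) (- d / n)); split; congr Quat;
   rewrite /n in n0 *; field.
Qed.

Definition sqnormC (R : rcfType) (z : R[i]) : R :=
  complex.Re z ^+ 2 + complex.Im z ^+ 2.

(** Equivalent to [b = a] or [b = conjc a], that is, to similarity of [a] and [b] as quaternions,
    but expressed by two real invariants. *)
Definition csim (R : rcfType) (a b : R[i]) : Prop :=
  complex.Re a = complex.Re b /\ sqnormC a = sqnormC b.

Lemma csim_sim (R : rcfType) (a b : R[i]) :
  csim a b -> sim (quat_of_complex a) (quat_of_complex b).
Proof.
case: a b => [a a'] [b b'] [/= <-]; rewrite /sqnormC /= => /addrI /eqP.
rewrite eqf_sqr => /orP[]/eqP ->; first exact: sim_refl.
(* Conjugation by [qj] induces complex conjugation on the complex numbers. *)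
exists qj, (- qj); split; congr Quat => /=; ring.
Qed.

(** * Triangularization and the characteristic polynomial of the complexification *)

Lemma sim_block_mx (S : nzRingType) n (w : S) (c : 'cV[S]_n) (D D' : 'M[S]_n) :
  sim D D' -> exists c', sim (block_mx w%:M 0 c D) (block_mx w%:M 0 c' D').
Proof.
case=> p [q [pq qp pD]]; exists (p *m c).
exists (block_mx (1%:M : 'M[S]_1) 0 0 p : 'M[S]_(1 + n)).
exists (block_mx (1%:M : 'M[S]_1) 0 0 q : 'M[S]_(1 + n)).
split; rewrite /GRing.mul /= !mulmx_block ?mulmx0 ?mul0mx ?mulmx1 ?mul1mx ?addr0 ?add0r.
- by rewrite -[p *m q]/(p * q) pq /= -scalar_mx_block.
- by rewrite -[q *m p]/(q * p) qp /= -scalar_mx_block.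
- by rewrite -[p *m D]/(p * D) -[D' *m p]/(D' * p) pD.
Qed.

(** Writing a quaternionic row as [u1 + u2 j], right multiplication by [A] acts on [(u1, u2)] as
    [complexify A]. A complex eigenrow of the latter therefore reads as a quaternionic one, scaled
    from the left. *)
Lemma eigenrow (R : rcfType) n (A : 'M[quat R]_n) : (0 < n)%N ->
  exists (w : 'rV[quat R]_n) (l : R[i]), w != 0 /\ w *m A = quat_of_complex l *: w.
Proof.
move=> n0; have [|l /eigenvalueP[u ul u0]] := eigenvalue_closed (complexify A).
  by rewrite addn_gt0 n0.
pose w := \row_j (quat_of_complex (lsubmx u 0 j) + quat_of_complex (rsubmx u 0 j) * qj).
have w1 j : qpart1 (w 0 j) = lsubmx u 0 j.
  rewrite mxE; case: (lsubmx u 0 j) (rsubmx u 0 j) => [??] [??].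
  by congr Complex => /=; ring.
have w2 j : qpart2 (w 0 j) = rsubmx u 0 j.
  rewrite mxE; case: (lsubmx u 0 j) (rsubmx u 0 j) => [??] [??].
  by congr Complex => /=; ring.
exists w, l; split.
  apply: contraNneq u0 => w0; rewrite -[u]hsubmxK -row_mx0; apply/eqP; congr row_mx.
    by apply/rowP => j; rewrite -w1 w0 !mxE.
  by apply/rowP => j; rewrite -w2 w0 !mxE.
move: ul; rewrite -[u]hsubmxK /complexify mul_row_block scale_row_mx.
move/eq_row_mx => [e1 e2].
have qE x y : qpart1 x = qpart1 y -> qpart2 x = qpart2 y -> x = y :> quat R.
  by move=> exy exy'; rewrite [x]qpartE exy exy' -qpartE.
have qcl1 : qpart1 (quat_of_complex l) = l by case: (l).
have qcl2 : qpart2 (quat_of_complex l) = 0 by [].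
apply/rowP => j; move/rowP/(_ j): e1; move/rowP/(_ j): e2.
rewrite ![(_ *: _ : 'rV[_]__) _ _]mxE => e2 e1; apply: qE.
  rewrite qpart1M qcl1 qcl2 mul0r subr0 w1 -e1 !mxE raddf_sum -big_split /=.
  by apply: eq_bigr => k _; rewrite qpart1M w1 w2 !mxE mulrN.
rewrite qpart2M qcl1 qcl2 mul0r addr0 w2 -e2 !mxE raddf_sum -big_split /=.
by apply: eq_bigr => k _; rewrite qpart2M w1 w2 !mxE.
Qed.

(** A transposition of columns brings a nonzero entry to the front; the permuted row is then the
    first row of a block triangular matrix with invertible diagonal. *)
Lemma complete_row (R : rcfType) n (w : 'rV[quat R]_(1 + n)) : w != 0 ->
  exists P Q : 'M[quat R]_(1 + n),
    [/\ P *m Q = 1%:M, Q *m P = 1%:M & row_mx 1%:M 0 *m P = w].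
Proof.
move=> w0; have [k wk] : exists k, w 0 k != 0.
  apply/existsP; apply: contraNT w0; rewrite negb_exists => /forallP w0.
  by apply/eqP/rowP => j; move: (w0 j); rewrite negbK mxE => /eqP.
pose s : {perm 'I_(1 + n)} := tperm ord0 k.
pose v := w *m perm_mx s.
have v0 : v 0 ord0 != 0.
  by rewrite /v -[s]invgK -col_permE mxE /s tpermV tpermL.
have [y [vy yv]] := quat_unitP v0.
have vE : v = row_mx (v 0 ord0)%:M (rsubmx v).
  rewrite -[LHS](@hsubmxK _ _ 1 n); congr row_mx.
  apply/matrixP => i j; rewrite !ord1 [RHS]mxE [LHS]mxE mulr1n.
  by congr (v _ _); apply: val_inj.
pose N : 'M[quat R]_(1 + n) := block_mx (v 0 ord0)%:M (rsubmx v) 0 1%:M.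
pose N' : 'M[quat R]_(1 + n) := block_mx y%:M (- (y *: rsubmx v)) 0 1%:M.
have NN' : N *m N' = 1%:M.
  rewrite mulmx_block !mulmx0 !mul0mx !mulmx1 !addr0 ?add0r -scalar_mxM vy.
  by rewrite mul_scalar_mx scalerN scalerA vy scale1r addNr -scalar_mx_block.
have N'N : N' *m N = 1%:M.
  rewrite mulmx_block !mulmx0 !mul0mx !mulmx1 !addr0 ?add0r -scalar_mxM yv.
  by rewrite mul_scalar_mx addrN -scalar_mx_block.
have ss : perm_mx s *m perm_mx s = 1%:M :> 'M[quat R]_(1 + n).
  by rewrite -perm_mxM tperm2 perm_mx1.
exists (N *m perm_mx s), (perm_mx s *m N'); split.
- by rewrite mulmxA -[N *m _ *m _]mulmxA ss mulmx1.
- by rewrite mulmxA -[_ *m N' *m _]mulmxA N'N mulmx1.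
- rewrite mulmxA mul_row_block !mul1mx !mul0mx !addr0 -vE /v.
  by rewrite -mulmxA ss mulmx1.
Qed.

(** The characteristic polynomial of [complexify A] evaluated at [m]; no sign appears because the
    dimension [n + n] is even. *)
Definition charH (R : rcfType) n (A : 'M[quat R]_n) (m : R[i]) : R[i] :=
  \det (complexify A - m%:M).

Lemma det_complexify_neq0 (R : rcfType) n (p q : 'M[quat R]_n) :
  p *m q = 1%:M -> \det (complexify p) != 0.
Proof.
move=> /(congr1 (fun X => \det (complexify X))); rewrite complexifyM complexify1.
by rewrite det_mulmx det1; apply: contra_eqN => /eqP ->; rewrite mul0r eq_sym oner_eq0.
Qed.

Lemma charH_sim (R : rcfType) n (A B : 'M[quat R]_n) :
  sim A B -> charH A =1 charH B.
Proof.
case=> p [q [pq _ pA]] m; have p0 := det_complexify_neq0 pq.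
apply: (mulfI p0); rewrite [RHS]mulrC -!det_mulmx mulmxBr mulmxBl -!complexifyM.
by rewrite -[p *m A]/(p * A) pA scalar_mxC.
Qed.

(** An injective reindexing is a permutation of rows and columns by the same [s]. The dimensions are
    only propositionally equal, so that [f] may regroup a sum of index types. *)
Lemma det_mxsub_inj (F : comNzRingType) m m' (f : 'I_m' -> 'I_m) (A : 'M[F]_m) :
  m' = m -> injective f -> \det (mxsub f f A) = \det A.
Proof.
move=> e; case: m / e f A => f A f_inj; pose s := perm f_inj.
have -> : mxsub f f A = perm_mx s *m A *m perm_mx s^-1.
  rewrite -row_permE -col_permE; apply/matrixP => i j.
  by rewrite !mxE !permE.
by rewrite !det_mulmx mulrAC -det_mulmx -perm_mxM mulgV perm_mx1 det1 mul1r.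
Qed.

Lemma quat_of_complex1 (R : rcfType) (l : R[i]) : qpart1 (quat_of_complex l) = l.
Proof. by case: l. Qed.

Lemma complexifyE (R : rcfType) n (B : 'M[quat R]_n) i j :
  [/\ complexify B (lshift n i) (lshift n j) = qpart1 (B i j),
      complexify B (lshift n i) (rshift n j) = qpart2 (B i j),
      complexify B (rshift n i) (lshift n j) = - conjc (qpart2 (B i j)) &
      complexify B (rshift n i) (rshift n j) = conjc (qpart1 (B i j))].
Proof. by split; rewrite ?(block_mxEul, block_mxEur, block_mxEdl, block_mxEdr) !mxE. Qed.

(* Moving the two indices that carry [l] and [conjc l] to the front makes the
   shifted complexification block lower triangular. *)
Lemma charH_block (R : rcfType) n (l : R[i]) (c : 'cV[quat R]_n) (D : 'M[quat R]_n) m :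
  charH (block_mx (quat_of_complex l)%:M 0 c D : 'M[quat R]_(1 + n)) m =
  (l - m) * (conjc l - m) * charH D m.
Proof.
pose f (i : 'I_(1 + (1 + (n + n)))) : 'I_((1 + n) + (1 + n)) :=
  match fintype.split i with
  | inl _ => lshift (1 + n) (lshift n ord0)
  | inr i => match fintype.split i with
    | inl _ => rshift (1 + n) (lshift n ord0)
    | inr i => match fintype.split i with
      | inl i => lshift (1 + n) (rshift 1 i)
      | inr i => rshift (1 + n) (rshift 1 i)
      end
    end
  end.
have f_inj : injective f.
  move=> i j; rewrite /f; case: (split_ordP i) => i0 ->; case: (split_ordP j) => j0 ->.
  - by rewrite !ord1.
  - case: (split_ordP j0) => j1 _; last case: (split_ordP j1) => j2 _.
    + by move/eqP; rewrite eq_shift.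
    + by move/eqP; rewrite !eq_shift.
    + by move/eqP; rewrite !eq_shift.
  - case: (split_ordP i0) => i1 _; last case: (split_ordP i1) => i2 _.
    + by move/eqP; rewrite eq_shift.
    + by move/eqP; rewrite !eq_shift.
    + by move/eqP; rewrite !eq_shift.
  - case: (split_ordP i0) => i1 ->; case: (split_ordP j0) => j1 ->.
    + by rewrite !ord1.
    + by case: (split_ordP j1) => j2 _ /eqP; rewrite !eq_shift.
    + by case: (split_ordP i1) => i2 _ /eqP; rewrite !eq_shift.
    + case: (split_ordP i1) => i2 ->; case: (split_ordP j1) => j2 -> /eqP;
      by rewrite !eq_shift // => /eqP ->.
have fl i : f (lshift _ i) = lshift (1 + n) (lshift n ord0).
  by rewrite /f; case: split_ordP => j /eqP; rewrite eq_shift.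
have frl i : f (rshift _ (lshift _ i)) = rshift (1 + n) (lshift n ord0).
  rewrite /f; case: split_ordP => j /eqP; rewrite eq_shift // => /eqP <-.
  by case: split_ordP => j' /eqP; rewrite eq_shift.
have frrl i : f (rshift _ (rshift _ (lshift _ i))) = lshift (1 + n) (rshift 1 i).
  rewrite /f; case: split_ordP => j /eqP; rewrite eq_shift // => /eqP <-.
  case: split_ordP => j' /eqP; rewrite eq_shift // => /eqP <-.
  by case: split_ordP => j'' /eqP; rewrite eq_shift // => /eqP ->.
have frrr i : f (rshift _ (rshift _ (rshift _ i))) = rshift (1 + n) (rshift 1 i).
  rewrite /f; case: split_ordP => j /eqP; rewrite eq_shift // => /eqP <-.
  case: split_ordP => j' /eqP; rewrite eq_shift // => /eqP <-.
  by case: split_ordP => j'' /eqP; rewrite eq_shift // => /eqP ->.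
rewrite /charH; set B := block_mx _ _ _ _; rewrite -(@det_mxsub_inj _ _ _ f) //.
set X := mxsub f f _.
have XE a b : X a b = complexify B (f a) (f b) - m *+ (a == b).
  by rewrite mxE [LHS]mxE [X in _ + X]mxE [X in _ - X]mxE (inj_eq f_inj).
have B00 : B (lshift n ord0) (lshift n ord0) = quat_of_complex l.
  by rewrite block_mxEul mxE mulr1n.
have B01 j : B (lshift n ord0) (rshift 1 j) = 0 by rewrite block_mxEur mxE.
have B11 i j : B (rshift 1 i) (rshift 1 j) = D i j by rewrite block_mxEdr.
have cE a b := complexifyE B a b.
have -> : X = block_mx (l - m)%:M 0 (dlsubmx X)
    (block_mx (conjc l - m)%:M 0 (dlsubmx (drsubmx X)) (complexify D - m%:M)).
  rewrite -[LHS](@submxK _ 1 _ 1); congr block_mx.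
  - apply/matrixP => i j; rewrite !ord1 [LHS]mxE [LHS]mxE [RHS]mxE XE fl.
    by have [-> _ _ _] := cE (lshift n ord0) (lshift n ord0); rewrite B00 quat_of_complex1.
  - apply/matrixP => i j; rewrite !ord1 [LHS]mxE [LHS]mxE [RHS]mxE XE fl eq_shift subr0.
    case: (split_ordP j) => j0 ->; last case: (split_ordP j0) => j1 ->.
    + by rewrite frl; have [_ -> _ _] := cE (lshift n ord0) (lshift n ord0); rewrite B00.
    + by rewrite frrl; have [-> _ _ _] := cE (lshift n ord0) (rshift 1 j1); rewrite B01.
    + by rewrite frrr; have [_ -> _ _] := cE (lshift n ord0) (rshift 1 j1); rewrite B01.
  rewrite -[LHS](@submxK _ 1 _ 1); congr block_mx.
  - apply/matrixP => i j; rewrite !ord1 [LHS]mxE [LHS]mxE [LHS]mxE [LHS]mxE [RHS]mxE XE frl.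
    have [_ _ _ ->] := cE (lshift n ord0) (lshift n ord0).
    by rewrite B00 quat_of_complex1 !eqxx.
  - apply/matrixP => i j; rewrite !ord1 [LHS]mxE [LHS]mxE [LHS]mxE [LHS]mxE [RHS]mxE XE frl.
    rewrite !eq_shift subr0; case: (split_ordP j) => j1 ->.
    + rewrite frrl; have [_ _ -> _] := cE (lshift n ord0) (rshift 1 j1).
      by rewrite B01 /= !oppr0.
    + rewrite frrr; have [_ _ _ ->] := cE (lshift n ord0) (rshift 1 j1).
      by rewrite B01 /= !oppr0.
  apply/matrixP => i j; rewrite [LHS]mxE [LHS]mxE [LHS]mxE [LHS]mxE XE.
  rewrite [RHS]mxE [X in _ = _ + X]mxE [X in _ = _ - X]mxE !eq_shift.
  case: (split_ordP i) => i1 ->; case: (split_ordP j) => j1 ->; rewrite ?frrl ?frrr;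
    have [e1 e2 e3 e4] := complexifyE D i1 j1;
    have [e1' e2' e3' e4'] := cE (rshift 1 i1) (rshift 1 j1).
  - by rewrite e1 e1' B11.
  - by rewrite e2 e2' B11.
  - by rewrite e3 e3' B11.
  - by rewrite e4 e4' B11.
by rewrite (@det_lblock _ 1) (@det_lblock _ 1) !det_scalar1 mulrA.
(* The remaining goal is the equality of dimensions required by [det_mxsub_inj]. *)
by rewrite [RHS]addnACA addnA.
Qed.

(** Induction on [n]: when an eigenrow is the first row of [P], the first row of [P A P^-1] is
    [(l0, 0)], and the lower right block is triangularized recursively. *)
Lemma triangular_form (R : rcfType) n (A : 'M[quat R]_n) :
  exists (T : 'M[quat R]_n) (l : 'I_n -> R[i]),
    [/\ sim A T, is_trig_mx T, forall i, T i i = quat_of_complex (l i) &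
        forall m, charH A m = \prod_i ((l i - m) * (conjc (l i) - m))].
Proof.
elim: n A => [|n IHn] A.
  exists A, (fun=> 0); split=> [| | [] // | m]; first exact: sim_refl.
    by apply/is_trig_mxP => -[].
  by rewrite big_ord0 /charH det_mx00.
rewrite -[n.+1]/(1 + n)%N in A *.
have [//|w [l0 [w0 wA]]] := eigenrow A.
have [P [Q [PQ QP e0P]]] := complete_row w0.
have [T [l [[p [q [pq qp pT]]] trT lT charT]]] := IHn (drsubmx (P *m A *m Q)).
pose B : 'M[quat R]_(1 + n) := P *m A *m Q.
have eB : B = block_mx (quat_of_complex l0)%:M 0 (dlsubmx B) (drsubmx B).
  have : row_mx 1%:M 0 *m B = row_mx (quat_of_complex l0)%:M 0.
    rewrite /B !mulmxA e0P wA -scalemxAl -[w in w *m Q]e0P -mulmxA PQ mulmx1.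
    by rewrite scale_row_mx scaler0 scalemx1.
  rewrite -{1}[B]submxK mul_row_block !mul1mx !mul0mx !addr0 => /eq_row_mx [e1 e2].
  by rewrite -[LHS]submxK e1 e2.
have AB : sim A B.
  by exists P, Q; split; rewrite // /B /GRing.mul /= -!mulmxA QP mulmx1.
have DT : sim (drsubmx B) T by exists p, q.
have [c AT] := sim_block_mx (quat_of_complex l0) (dlsubmx B) DT.
rewrite -eB in AT.
exists (block_mx (quat_of_complex l0)%:M 0 c T : 'M[quat R]_(1 + n)).
exists (fun i => match fintype.split i with inl _ => l0 | inr i => l i end).
have AT' := sim_trans AB AT.
split=> //.
- by rewrite is_trig_block_mx // eqxx trT scalar_mx_is_trig.
- move=> i; case: split_ordP => j ->; first by rewrite block_mxEul ord1 mxE.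
  by rewrite block_mxEdr lT.
- move=> m; rewrite (charH_sim AT') charH_block big_split_ord big_ord1 /=.
  congr (_ * _).
    by case: split_ordP => j /eqP; rewrite eq_shift.
  rewrite -(charH_sim DT) charT; apply: eq_bigr => i _.
  by case: split_ordP => j /eqP; rewrite eq_shift // => /eqP ->.
Qed.

(** * Positivity of the determinant and rescaling into SL *)

Lemma mul_conjc (R : rcfType) (z : R[i]) : z * conjc z = (sqnormC z)%:C%C.
Proof. by case: z => a b; rewrite /sqnormC; congr Complex => /=; ring. Qed.

Lemma detH_gt0 (R : rcfType) n (p q : 'M[quat R]_n) :
  p *m q = 1%:M -> exists2 d : R, 0 < d & detH p = d%:C%C.
Proof.
move=> pq; have := det_complexify_neq0 pq; rewrite -/(detH p).
have [T [l [_ _ _ charp]]] := triangular_form p.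
have -> : detH p = (\prod_i sqnormC (l i))%:C%C.
  have -> : detH p = charH p 0 by rewrite /charH raddf0 subr0.
  rewrite charp rmorph_prod; apply: eq_bigr => i _.
  by rewrite !subr0 mul_conjc.
set d := \prod_i _ => d0; exists d => //; rewrite lt_def prodr_ge0 ?andbT.
  by apply: contraNneq d0 => ->.
by move=> i _; rewrite addr_ge0 ?sqr_ge0.
Qed.

Lemma real_mxC (R : rcfType) n (r : R) (A : 'M[quat R]_n) :
  (Quat r 0 0 0)%:M *m A = A *m (Quat r 0 0 0)%:M.
Proof.
rewrite -diag_const_mx mul_mx_diag mul_diag_mx; apply/matrixP => i j; rewrite !mxE.
by case: (A i j) => a b c d; congr Quat => /=; ring.
Qed.

Lemma detH_real (R : rcfType) n (r : R) :
  detH ((Quat r 0 0 0)%:M : 'M[quat R]_n) = (r ^+ (n + n))%:C%C.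
Proof.
rewrite /detH; have -> : complexify (Quat r 0 0 0)%:M = (r%:C%C)%:M :> 'M[R[i]]_(n + n).
  rewrite -[RHS](submxK) /complexify.
  by congr block_mx; apply/matrixP => i j; rewrite !mxE ?eq_shift ?(inj_eq val_inj) //=;
    case: eqP => //= _; congr Complex; rewrite ?oppr0.
by rewrite det_scalar rmorphXn.
Qed.

Lemma scale_into_SLH (R : realType) n (p q : 'M[quat R]_n.+1) : p *m q = 1%:M ->
  exists (g : SLH R n.+1) (r : R), SLmx g = (Quat r 0 0 0)%:M *m p.
Proof.
move=> pq; have [d d0 dp] := detH_gt0 pq.
(* The real scalar [r] multiplies [detH] by [r ^+ (n.+1 + n.+1)], so [r] is the corresponding root
   of [d^-1]. *)
pose r := expR (- ln d / (n.+1 + n.+1)%:R).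
have dr : detH ((Quat r 0 0 0)%:M *m p) == 1.
  rewrite detHM detH_real dp -rmorphM /r /=.
  rewrite -expRM_natl [X in expR X]mulrC divfK ?pnatr_eq0 // expRN lnK ?posrE //.
  by rewrite mulVf ?lt0r_neq0.
by exists (MkSLH dr), r.
Qed.

(** Real scalars are central, so rescaling an invertible matrix into SL does not change the
    conjugation by it. The same argument gives [reversibleP]. *)
Lemma SLH_conjugateP (R : realType) n (A : SLH R n.+1) M :
  SLH_conjugate A M <-> sim (SLmx A) M.
Proof.
split=> [[g gA]|[p [q [pq qp pA]]]].
  exists (SLmx g), (SLmx g^-1%g); split.
  - by rewrite -[LHS]/(SLmx (g * g^-1)%g) mulgV.
  - by rewrite -[LHS]/(SLmx (g^-1 * g)%g) mulVg.
  - by rewrite -gA -[RHS]/(SLmx (g * A * g^-1 * g)%g) mulgVK.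
have [g [r gE]] := scale_into_SLH pq; exists g.
have gA : SLmx g *m SLmx A = M *m SLmx g.
  by rewrite gE -mulmxA -[p *m _]/(p * _) pA mulmxA real_mxC -mulmxA.
by rewrite -[LHS]/(SLmx g *m SLmx A *m invHmx (SLmx g)) gA -mulmxA mulHmxV ?SLH_det ?mulmx1.
Qed.

Lemma reversibleP (R : realType) n (A : SLH R n.+1) :
  (exists g : SLH R n.+1, SLmx (g * A * g^-1)%g = - SLmx (A^-1)%g) <->
  reversible (SLmx A).
Proof.
split=> [[g gA]|[p [q [pq qp ApA]]]].
  exists (SLmx g), (SLmx g^-1%g); split.
  - by rewrite -[LHS]/(SLmx (g * g^-1)%g) mulgV.
  - by rewrite -[LHS]/(SLmx (g^-1 * g)%g) mulVg.
  - have gA' : SLmx (g * A)%g = - SLmx (A^-1 * g)%g.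
      by rewrite -[RHS]mulNmx -gA -[RHS]/(SLmx (g * A * g^-1 * g)%g) mulgVK.
    rewrite -mulrA -[SLmx g * _]/(SLmx (g * A)%g) gA' mulrN.
    by rewrite -[_ * _]/(SLmx (A * (A^-1 * g))%g) mulKVg.
have [g [r gE]] := scale_into_SLH pq; exists g.
have AgA : SLmx A *m SLmx g *m SLmx A = - SLmx g.
  rewrite gE mulmxA -real_mxC -!mulmxA [SLmx A *m _]mulmxA.
  by rewrite -[_ *m SLmx A]/(SLmx A * p * SLmx A) ApA mulmxN.
have -> : (g * A * g^-1 = A^-1 * (A * g * A) * g^-1)%g by rewrite !mulgA mulVg mul1g.
rewrite -[LHS]/(SLmx A^-1%g *m (SLmx A *m SLmx g *m SLmx A) *m SLmx g^-1%g) AgA.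
rewrite mulmxN mulNmx; congr (- _).
by rewrite -[LHS]/(SLmx (A^-1 * g * g^-1)%g) mulgK.
Qed.

(** * Eigenvalue classes of a reversible matrix *)

(** From [X Y X = - Y] one gets [(X - m) Y X = - m Y (X + m^-1)]. Take determinants, with
    [det X = 1] and [det Y] nonzero; the even dimension removes the sign of [- m]. *)
Lemma charH_reversible (R : rcfType) n (A : 'M[quat R]_n) m :
  reversible A -> detH A = 1 -> m != 0 ->
  charH A m = m ^+ (n + n) * charH A (- m^-1).
Proof.
case=> p [q [pq _ ApA]] dA m0; have p0 := det_complexify_neq0 pq.
set X := complexify A; set Y := complexify p.
have XYX : X *m Y *m X = - Y.
  rewrite -!complexifyM -[A *m p *m A]/(A * p * A) ApA.
  by apply/eqP; rewrite -subr_eq0 opprK /Y /complexify add_block_mx -block_mx0;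
    apply/eqP; congr block_mx; apply/matrixP => i j;
    rewrite !mxE ?(raddfN, rmorphN) /= ?addNr ?addrN.
have key : (X - m%:M) *m (Y *m X) = (- m)%:M *m (Y *m (X - (- m^-1)%:M)).
  rewrite mulmxBl mulmxA XYX [Y *m (_ - _)]mulmxBr scalar_mxC mulmxBr.
  have mm : (- m) * (- m^-1) = 1 by rewrite mulrNN mulfV.
  rewrite [(- m)%:M *m ((- m^-1)%:M *m Y)]mulmxA -scalar_mxM mm mul1mx.
  by rewrite raddfN mulNmx addrC.
apply: (mulfI p0); transitivity (\det ((X - m%:M) *m (Y *m X))).
  by rewrite !det_mulmx -/(detH A) dA mulr1 mulrC.
rewrite key !det_mulmx det_scalar mulrCA; congr (_ * (_ * _)).
by rewrite exprNn addnn -mul2n exprM sqrrN !expr1n mul1r.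
Qed.

Lemma csim_refl (R : rcfType) (a : R[i]) : csim a a.
Proof. by []. Qed.

Lemma csim_conj (R : rcfType) (a : R[i]) : csim a (conjc a).
Proof. by case: a => a b; split; rewrite // /sqnormC /= sqrrN. Qed.

Lemma csim_sym (R : rcfType) (a b : R[i]) : csim a b -> csim b a.
Proof. by case. Qed.

Lemma csim_trans (R : rcfType) (b a c : R[i]) : csim a b -> csim b c -> csim a c.
Proof. by case=> [e1 e2] [e3 e4]; split; rewrite ?e1 ?e2. Qed.

(** Reads a similarity class off a zero of [charH]; [root_csim] is the converse. *)
Lemma csim_root (R : rcfType) (z m : R[i]) :
  (z - m) * (conjc z - m) = 0 -> csim z m.
Proof.
move=> /eqP; rewrite mulf_eq0 !subr_eq0 => /orP[/eqP -> //|/eqP <-].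
exact: csim_conj.
Qed.

Lemma root_csim (R : rcfType) (z m : R[i]) :
  csim z m -> (z - m) * (conjc z - m) = 0.
Proof.
case: z m => [a b] [c d]; rewrite /csim /sqnormC /= => -[<- e].
have {}e : b ^+ 2 = d ^+ 2 by lra.
by congr Complex => /=; ring: e.
Qed.

Lemma sqnormC_inv (R : rcfType) (z : R[i]) : sqnormC (- z^-1) = (sqnormC z)^-1.
Proof.
case: z => a b; rewrite /sqnormC /=; set n := a ^+ 2 + b ^+ 2.
have [n0|n0] := eqVneq n 0; first by rewrite n0 invr0 !mulr0 !oppr0 expr0n addr0.
by rewrite /n in n0 *; field.
Qed.

Lemma Re_inv (R : rcfType) (z : R[i]) :
  complex.Re (- z^-1) = - (complex.Re z / sqnormC z).
Proof. by case: z => a b. Qed.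

Lemma sqnormC_ge0 (R : rcfType) (z : R[i]) : 0 <= sqnormC z.
Proof. by rewrite addr_ge0 ?sqr_ge0. Qed.

Lemma sqnormC_eq0 (R : rcfType) (z : R[i]) : (sqnormC z == 0) = (z == 0).
Proof.
case: z => a b; rewrite /sqnormC paddr_eq0 ?sqr_ge0 // !sqrf_eq0 /=.
by apply/andP/eqP => [[/eqP -> /eqP ->]|[-> ->]].
Qed.

(** Equality of moduli forces [|z| = 1]; then [- z^-1] is [- conjc z], and equality of real parts
    forces [Re z = 0]. *)
Lemma csim_neg_inv (R : rcfType) (z : R[i]) :
  z != 0 -> csim z (- z^-1) -> csim z (Complex 0 1).
Proof.
rewrite -sqnormC_eq0 => z0; rewrite /csim Re_inv sqnormC_inv => -[ea en].
have n1 : sqnormC z = 1.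
  have := sqnormC_ge0 z; have : sqnormC z * sqnormC z = 1 by rewrite {1}en mulVf.
  nra.
split; rewrite ?n1 /sqnormC /=; last by rewrite expr0n expr1n add0r.
by move: ea; rewrite n1 divr1; lra.
Qed.

(** Each pair [a], [n] stands for the real part and squared modulus of an eigenvalue. The
    substitution of [- m^-1] exchanges the first two quadratic factors, so they cancel, and the
    third one must satisfy the functional equation alone. *)
Lemma third_root_real (R : realFieldType) (a0 n0 a1 n1 a2 n2 : R) :
  a0 ^+ 2 <= n0 -> a1 ^+ 2 <= n1 -> n0 != 0 -> a1 = - (a0 / n0) -> n1 = n0^-1 ->
  n0 * n1 * n2 = 1 ->
  (forall m, m != 0 ->
    (m ^+ 2 - 2 * a0 * m + n0) * (m ^+ 2 - 2 * a1 * m + n1)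
      * (m ^+ 2 - 2 * a2 * m + n2) =
    m ^+ 6 * (((- m^-1) ^+ 2 - 2 * a0 * (- m^-1) + n0)
      * ((- m^-1) ^+ 2 - 2 * a1 * (- m^-1) + n1)
      * ((- m^-1) ^+ 2 - 2 * a2 * (- m^-1) + n2))) ->
  a2 = 0 /\ n2 = 1.
Proof.
move=> h0 h1 n00 ea1 en1 nn H.
have n21 : n2 = 1 by move: nn; rewrite en1 mulfV // mul1r.
(* A single evaluation suffices, provided the cancelled factors do not vanish: for [m] above [a0]
   and [a1] they are at least [(m - a0)^2] and [(m - a1)^2], both positive. *)
split=> //; pose m := 1 + `|a0| + `|a1|.
have m0 : 0 < m by rewrite /m -addrA ltr_pwDl // addr_ge0.
have mn0 := lt0r_neq0 m0.
have q_gt0 a n : a ^+ 2 <= n -> a < m -> 0 < m ^+ 2 - 2 * a * m + n.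
  move=> han am; rewrite -subr_gt0 in am; have := mulr_gt0 am am; lra.
have q0 : 0 < m ^+ 2 - 2 * a0 * m + n0.
  apply: q_gt0 => //; rewrite /m; have := ler_norm a0; have := normr_ge0 a1; lra.
have q1 : 0 < m ^+ 2 - 2 * a1 * m + n1.
  apply: q_gt0 => //; rewrite /m; have := ler_norm a1; have := normr_ge0 a0; lra.
have q01 := lt0r_neq0 (mulr_gt0 q0 q1).
have := H m mn0.
(* After multiplication by [m ^+ 2], the first factor at [- m^-1] is [n0] times the second at [m],
   and the second is [n0^-1] times the first at [m]. *)
have -> : m ^+ 6 * (((- m^-1) ^+ 2 - 2 * a0 * (- m^-1) + n0)
      * ((- m^-1) ^+ 2 - 2 * a1 * (- m^-1) + n1)
      * ((- m^-1) ^+ 2 - 2 * a2 * (- m^-1) + n2)) =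
   (m ^+ 2 - 2 * a0 * m + n0) * (m ^+ 2 - 2 * a1 * m + n1) *
   (1 + 2 * a2 * m + n2 * m ^+ 2).
  by rewrite ea1 en1; field; rewrite n00.
move/(mulfI q01); rewrite n21 => e.
have : a2 * m = 0 by lra.
by move/eqP; rewrite mulf_eq0 (negPf mn0) orbF => /eqP.
Qed.

Lemma perm_ord3 (i j : 'I_3) : j != i ->
  exists s : 'S_3, s 0 = i /\ s 1 = j.
Proof.
move=> ji; exists (tperm 1%R (tperm 0%R i j) * tperm 0%R i)%g.
split; rewrite permM; last by rewrite tpermL tpermK.
rewrite [tperm 1 _ 0]tpermD ?tpermL //; apply: contraNneq ji => e.
by have /eqP := congr1 (tperm 0 i) e; rewrite tpermK tpermL.
Qed.

Lemma eigenvalue_classes (R : rcfType) (A : 'M[quat R]_3) (l : 'I_3 -> R[i]) :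
  reversible A -> detH A = 1 ->
  (forall m, charH A m = \prod_i ((l i - m) * (conjc (l i) - m))) ->
  (forall i, csim (l i) (Complex 0 1)) \/
  exists s : 'S_3, [/\ ~ csim (l (s 0)) (Complex 0 1),
    l (s 0) != 0, csim (l (s 1)) (- (l (s 0))^-1) & csim (l (s 2)) (Complex 0 1)].
Proof.
move=> revA dA charA.
have rel := charH_reversible revA dA.
have dl : \prod_i sqnormC (l i) = 1.
  have := charA 0; rewrite /charH raddf0 subr0 -/(detH A) dA.
  under eq_bigr do rewrite !subr0 mul_conjc.
  by rewrite -rmorph_prod => /(congr1 (@complex.Re R)).
have n0 i : sqnormC (l i) != 0.
  by apply/eqP => e; move/eqP: dl; rewrite (bigD1 i) //= e mul0r eq_sym oner_eq0.
have l0 i : l i != 0.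
  by apply: contraNneq (n0 i) => ->; rewrite /sqnormC /= expr0n addr0.
have [//|] := pselect (forall i, csim (l i) (Complex 0 1)); first by left.
move=> /existsNP [i li]; right.
(* [charH A] vanishes at [l i], hence at [- (l i)^-1] by [charH_reversible]; the factor that
   vanishes there supplies the index [j]. *)
have : \prod_j ((l j - - (l i)^-1) * (conjc (l j) - - (l i)^-1)) = 0.
  apply/eqP; rewrite -charA -(mulrI_eq0 _ (@mulfI _ _ (expf_neq0 (3 + 3) (l0 i)))).
  rewrite -rel // charA (bigD1 i) //=.
  by rewrite (root_csim (csim_refl _)) mul0r.
move/eqP/prodf_eq0 => [j _ /eqP /csim_root lj].
have ji : j != i.
  by apply: contra_not_neq li => ji; apply: csim_neg_inv (l0 i) _; rewrite -{1}ji.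
have [s [s0 s1]] := perm_ord3 ji.
exists s; rewrite s0 s1; split=> //.
have prodE (F : 'I_3 -> R[i]) : \prod_k F k = F i * F j * F (s 2).
  rewrite (reindex_inj (@perm_inj _ s)) !big_ord_recl big_ord0 /= mulr1 mulrA.
  by congr (F _ * F _ * F _); rewrite -?s0 -?s1; congr (s _); apply: val_inj.
have sq z : complex.Re z ^+ 2 <= sqnormC z :> R by rewrite lerDl sqr_ge0.
(* At a real [m] every pair of conjugate factors is a real quadratic, as [third_root_real]
   requires. *)
have QE z (m : R) : (z - m%:C%C) * (conjc z - m%:C%C) =
    (m ^+ 2 - 2 * complex.Re z * m + sqnormC z)%:C%C.
  by case: z => a b; rewrite /sqnormC; congr Complex => /=; ring.
have [lj1 lj2] := lj; rewrite Re_inv in lj1; rewrite sqnormC_inv in lj2.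
have [||a2 n2] := third_root_real (sq (l i)) (sq (l j)) (n0 i) lj1 lj2
  (a2 := complex.Re (l (s 2))) (n2 := sqnormC (l (s 2))).
- apply: (@complexI R); rewrite !rmorphM -(prodE (fun k => (sqnormC (l k))%:C%C)).
  by rewrite -rmorph_prod dl.
- move=> m m0; apply: (@complexI R); have m0' : m%:C%C != 0 :> R[i] by rewrite fmorph_eq0.
  have := rel m%:C%C m0'; rewrite !charA !prodE.
  have -> : - (m%:C%C)^-1 = (- m^-1)%:C%C :> R[i] by rewrite rmorphN fmorphV.
  by rewrite !QE -rmorphXn -!rmorphM.
by split; rewrite ?a2 ?n2 // /sqnormC /= expr0n expr1n add0r.
Qed.

(** * Explicit 3 by 3 matrices and elementary conjugations *)

(** A one-sided inverse suffices: complexification is injective and multiplicative, and complex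
    square matrices have two-sided inverses. *)
Lemma sim_mx (R : rcfType) n (P Q A B : 'M[quat R]_n) :
  P *m Q = 1%:M -> P *m A = B *m P -> sim A B.
Proof.
move=> PQ PA; exists P, Q; split=> //; apply: complexify_inj.
by rewrite complexifyM complexify1; apply: mulmx1C; rewrite -complexifyM PQ complexify1.
Qed.

Lemma mul_mx3 (R : rcfType) (a11 a12 a13 a21 a22 a23 a31 a32 a33
    b11 b12 b13 b21 b22 b23 b31 b32 b33 : quat R) :
  mx3 [:: [:: a11; a12; a13]; [:: a21; a22; a23]; [:: a31; a32; a33]] *m
  mx3 [:: [:: b11; b12; b13]; [:: b21; b22; b23]; [:: b31; b32; b33]] =
  mx3 [:: [:: a11 * b11 + a12 * b21 + a13 * b31; a11 * b12 + a12 * b22 + a13 * b32;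
              a11 * b13 + a12 * b23 + a13 * b33];
          [:: a21 * b11 + a22 * b21 + a23 * b31; a21 * b12 + a22 * b22 + a23 * b32;
              a21 * b13 + a22 * b23 + a23 * b33];
          [:: a31 * b11 + a32 * b21 + a33 * b31; a31 * b12 + a32 * b22 + a33 * b32;
              a31 * b13 + a32 * b23 + a33 * b33]].
Proof.
apply/matrixP => i j; rewrite mxE !big_ord_recl big_ord0 addr0 !mxE addrA.
by case: i j => [[|[|[|//]]] ?] [[|[|[|//]]] ?].
Qed.

Lemma mx3_eta (R : rcfType) (A : 'M[quat R]_3) :
  A = mx3 [:: [:: A 0 0; A 0 1; A 0 2]; [:: A 1 0; A 1 1; A 1 2];
              [:: A 2 0; A 2 1; A 2 2]].
Proof.
apply/matrixP => i j; rewrite mxE.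
by case: i j => [[|[|[|//]]] ?] [[|[|[|//]]] ?] /=; congr (A _ _); apply: val_inj.
Qed.

Lemma mx3_1 (R : rcfType) :
  mx3 [:: [:: 1; 0; 0]; [:: 0; 1; 0]; [:: 0; 0; 1]] = 1%:M :> 'M[quat R]_3.
Proof. by rewrite [RHS]mx3_eta !mxE. Qed.

Lemma opp_mx3 (R : rcfType) (a11 a12 a13 a21 a22 a23 a31 a32 a33 : quat R) :
  - mx3 [:: [:: a11; a12; a13]; [:: a21; a22; a23]; [:: a31; a32; a33]] =
  mx3 [:: [:: - a11; - a12; - a13]; [:: - a21; - a22; - a23]; [:: - a31; - a32; - a33]].
Proof.
by apply/matrixP => -[[|[|[|//]]] ?] [[|[|[|//]]] ?]; rewrite !mxE.
Qed.

Definition lower3 (R : rcfType) (a b c x y z : quat R) : 'M[quat R]_3 :=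
  mx3 [:: [:: a; 0; 0]; [:: x; b; 0]; [:: y; z; c]].

Lemma trig_lower3 (R : rcfType) (T : 'M[quat R]_3) :
  is_trig_mx T -> T = lower3 (T 0 0) (T 1 1) (T 2 2) (T 1 0) (T 2 0) (T 2 1).
Proof. by move/is_trig_mxP => T0; rewrite [LHS]mx3_eta (T0 0 1) ?(T0 0 2) ?(T0 1 2). Qed.

Lemma lower3_sim10 (R : rcfType) (a b c x y z s : quat R) :
  sim (lower3 a b c x y z) (lower3 a b c (x + (s * a - b * s)) (y - z * s) z).
Proof.
apply: (@sim_mx _ _ (lower3 1 1 1 s 0 0) (lower3 1 1 1 (- s) 0 0)).
  rewrite mul_mx3 -mx3_1 !(mulr0, mul0r, mulr1, mul1r, addr0, add0r).
  by rewrite addrN.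
rewrite !mul_mx3 !(mulr0, mul0r, mulr1, mul1r, addr0, add0r).
by rewrite -!addrA !addNr !addr0 [x + _]addrC.
Qed.

Lemma lower3_sim21 (R : rcfType) (a b c x y z s : quat R) :
  sim (lower3 a b c x y z) (lower3 a b c x (y + s * x) (z + (s * b - c * s))).
Proof.
apply: (@sim_mx _ _ (lower3 1 1 1 0 0 s) (lower3 1 1 1 0 0 (- s))).
  rewrite mul_mx3 -mx3_1 !(mulr0, mul0r, mulr1, mul1r, addr0, add0r).
  by rewrite addrN.
rewrite !mul_mx3 !(mulr0, mul0r, mulr1, mul1r, addr0, add0r).
by rewrite -!addrA !addNr !addr0 [y + _]addrC [z + _]addrC.
Qed.

Lemma lower3_sim20 (R : rcfType) (a b c x y z s : quat R) :
  sim (lower3 a b c x y z) (lower3 a b c x (y + (s * a - c * s)) z).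
Proof.
apply: (@sim_mx _ _ (lower3 1 1 1 0 s 0) (lower3 1 1 1 0 (- s) 0)).
  rewrite mul_mx3 -mx3_1 !(mulr0, mul0r, mulr1, mul1r, addr0, add0r).
  by rewrite addrN.
rewrite !mul_mx3 !(mulr0, mul0r, mulr1, mul1r, addr0, add0r).
by rewrite -!addrA !addNr !addr0 [y + _]addrC.
Qed.

(** Correcting the entries [x] and [z] next to the diagonal disturbs only [y], and correcting [y]
    disturbs neither, so [y] is treated last. The property [f] will be commuting with [qi], or being
    zero. *)
Lemma lower3_reduce (R : rcfType) (a b c x y z : quat R) (f : quat R -> Prop) :
  (forall x, exists s, f (x + (s * a - b * s))) ->
  (forall y, exists s, f (y + (s * a - c * s))) ->
  (forall z, exists s, f (z + (s * b - c * s))) ->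
  exists x' y' z', [/\ f x', f y', f z' &
    sim (lower3 a b c x y z) (lower3 a b c x' y' z')].
Proof.
move=> h10 h20 h21.
have [s10 e10] := h10 x; have [s21 e21] := h21 z.
have [s20 e20] := h20 (y - z * s10 + s21 * (x + (s10 * a - b * s10))).
do 3!eexists; split; [exact: e10 | exact: e20 | exact: e21 |].
apply: sim_trans (lower3_sim10 _ _ _ _ _ _ s10) _.
apply: sim_trans (lower3_sim21 _ _ _ _ _ _ s21) _.
exact: lower3_sim20.
Qed.

(** * Simplifying the off-diagonal entries *)

(** On the plane of [qj] and [qk] the map sending [s] to [s * qi - qi * s] is invertible, so these
    two components of [x] can be cancelled and a complex number remains. *)
Lemma commute_qi_solve (R : rcfType) (x : quat R) :
  exists s, (x + (s * qi - qi * s)) * qi = qi * (x + (s * qi - qi * s)).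
Proof.
case: x => p q r t; exists (Quat 0 0 (t / 2) (- (r / 2))).
by congr Quat => /=; field.
Qed.

Lemma quat_of_complexM (R : rcfType) (z w : R[i]) :
  quat_of_complex (z * w) = quat_of_complex z * quat_of_complex w.
Proof. by case: z w => [? ?] [? ?]; congr Quat => /=; ring. Qed.

(** [f] is the real quadratic with roots [b] and [conjc b], evaluated at [a]. As [b + conjc b] and
    [b * conjc b] are central, [s := conjc b * x - x * a] satisfies [s * a - b * s = - x * f]; it
    remains to divide by [f], which commutes with [a]. *)
Lemma sylvester_solve (R : rcfType) (a b : R[i]) (x : quat R) : ~ csim a b ->
  exists s, x + (s * quat_of_complex a - quat_of_complex b * s) = 0.
Proof.
move=> ab; pose f := (a - b) * (a - conjc b).
have f0 : f != 0.
  apply: contra_not_neq ab => /eqP; rewrite mulf_eq0 !subr_eq0.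
  by move=> /orP[]/eqP ->; [|apply: csim_sym; apply: csim_conj].
pose g := f^-1; pose s := quat_of_complex (conjc b) * x - x * quat_of_complex a.
exists (s * quat_of_complex g).
have e : s * quat_of_complex a - quat_of_complex b * s = - (x * quat_of_complex f).
  rewrite /s /f; case: (a) (b) (x) => [a1 a2] [b1 b2] [x1 x2 x3 x4].
  by congr Quat => /=; ring.
rewrite -mulrA -quat_of_complexM [g * a]mulrC quat_of_complexM !mulrA -mulrBl e.
by rewrite mulNr -mulrA -quat_of_complexM mulfV // -[quat_of_complex 1]/(1 : quat R) mulr1 addrN.
Qed.

Lemma trig_diag_sim (R : rcfType) n (T : 'M[quat R]_n) (d : 'I_n -> quat R) :
  is_trig_mx T -> (forall i, sim (T i i) (d i)) ->
  exists T', [/\ sim T T', is_trig_mx T' & forall i, T' i i = d i].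
Proof.
move=> /is_trig_mxP T0 /fin_all_exists[p /fin_all_exists[q pq]].
pose P := diag_mx (\row_i p i); pose Q := diag_mx (\row_i q i).
have PQ : P *m Q = 1%:M.
  rewrite mulmx_diag -diag_const_mx; congr diag_mx; apply/rowP => i; rewrite !mxE.
  by have [-> _ _] := pq i.
have QP : Q *m P = 1%:M.
  rewrite mulmx_diag -diag_const_mx; congr diag_mx; apply/rowP => i; rewrite !mxE.
  by have [_ -> _] := pq i.
have E i j : (P *m T *m Q) i j = p i * T i j * q j.
  by rewrite mul_mx_diag mxE mul_diag_mx !mxE.
exists (P *m T *m Q); split.
- by apply: (sim_mx PQ); rewrite -[RHS]mulmxA QP mulmx1.
- by apply/is_trig_mxP => i j ij; rewrite E T0 // mulr0 mul0r.
- by move=> i; rewrite E; have [e _ ->] := pq i; rewrite -mulrA e mulr1.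
Qed.

Lemma diag_perm_sim (R : rcfType) n (r : 'rV[quat R]_n) (s : 'S_n) :
  sim (diag_mx r) (diag_mx (\row_i r 0 (s i))).
Proof.
apply: (@sim_mx _ _ (perm_mx s) (perm_mx s^-1)).
  by rewrite -perm_mxM mulgV perm_mx1.
rewrite -row_permE mul_diag_mx; apply/matrixP => i j; rewrite !mxE.
by rewrite -mulr_natr.
Qed.

(** Let [N] be the strictly lower triangular part of [T]. All entries commute with [qi], so a matrix
    whose rows form Jordan chains [v, v N, ...] conjugates [T] to Jordan form. The cases are
    [N = 0], [N^2 = 0], and [N^2] nonzero, its only possible entry being [z * x]. *)
Lemma nilpotent_normal_form (R : rcfType) (x y z : quat R) :
  x * qi = qi * x -> y * qi = qi * y -> z * qi = qi * z ->
  let T := lower3 qi qi qi x y z in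
  [\/ T = lower3 qi qi qi 0 0 0,
      sim T (mx3 [:: [:: qi; 1; 0]; [:: 0; qi; 0]; [:: 0; 0; qi]]) |
      sim T (mx3 [:: [:: qi; 1; 0]; [:: 0; qi; 1]; [:: 0; 0; qi]])].
Proof.
move=> xi yi zi T.
have [x0|/quat_unitP[x' [xx' x'x]]] := eqVneq x 0;
have [z0|/quat_unitP[z' [zz' z'z]]] := eqVneq z 0.
- have [y0|/quat_unitP[y' [yy' y'y]]] := eqVneq y 0.
    by apply: Or31; rewrite /T x0 y0 z0.
  apply: Or32; rewrite /T x0 z0.
  apply: (@sim_mx _ _ (mx3 [:: [:: 0; 0; 1]; [:: y; 0; 0]; [:: 0; 1; 0]])
                      (mx3 [:: [:: 0; y'; 0]; [:: 0; 0; 1]; [:: 1; 0; 0]])).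
    by rewrite mul_mx3 -mx3_1 !(mulr0, mul0r, mulr1, mul1r, addr0, add0r) yy'.
  by rewrite !mul_mx3 !(mulr0, mul0r, mulr1, mul1r, addr0, add0r) yi.
- apply: Or32; rewrite /T x0.
  apply: (@sim_mx _ _ (mx3 [:: [:: 0; 0; 1]; [:: y; z; 0]; [:: 1; 0; 0]])
                      (mx3 [:: [:: 0; 0; 1]; [:: 0; z'; - (z' * y)]; [:: 1; 0; 0]])).
    rewrite mul_mx3 -mx3_1 !(mulr0, mul0r, mulr1, mul1r, addr0, add0r) zz'.
    by rewrite mulrN mulrA zz' mul1r addrN.
  by rewrite !mul_mx3 !(mulr0, mul0r, mulr1, mul1r, addr0, add0r) yi zi.
- apply: Or32; rewrite /T z0.
  have x'i : x' * qi = qi * x'.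
    by rewrite -[LHS]mulr1 -xx' mulrA -[x' * qi * x]mulrA -xi mulrA x'x mul1r.
  (* The third row is chosen in the left kernel of [N]. *)
  apply: (@sim_mx _ _ (mx3 [:: [:: 0; 1; 0]; [:: x; 0; 0]; [:: 0; - (y * x'); 1]])
                      (mx3 [:: [:: 0; x'; 0]; [:: 1; 0; 0]; [:: y * x'; 0; 1]])).
    rewrite mul_mx3 -mx3_1 !(mulr0, mul0r, mulr1, mul1r, addr0, add0r) xx'.
    by rewrite addNr.
  rewrite !mul_mx3 !(mulr0, mul0r, mulr1, mul1r, addr0, add0r) xi.
  by rewrite !mulNr !mulrN -[y * x' * x]mulrA x'x mulr1 addNr -mulrA x'i !mulrA yi.
- apply: Or33; rewrite /T.
  have [x'z'] : exists w, z * x * w = 1 /\ w * (z * x) = 1.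
    exists (x' * z'); split.
      by rewrite mulrA -[z * x * x']mulrA xx' mulr1.
    by rewrite mulrA -[x' * z' * z]mulrA z'z mulr1.
  case=> zxw wzx.
  apply: (@sim_mx _ _ (mx3 [:: [:: 0; 0; 1]; [:: y; z; 0]; [:: z * x; 0; 0]])
     (mx3 [:: [:: 0; 0; x'z']; [:: 0; z'; - (z' * y * x'z')]; [:: 1; 0; 0]])).
    rewrite mul_mx3 -mx3_1 !(mulr0, mul0r, mulr1, mul1r, addr0, add0r) zz' zxw.
    by rewrite mulrN !mulrA zz' mul1r addrN.
  rewrite !mul_mx3 !(mulr0, mul0r, mulr1, mul1r, addr0, add0r) yi zi.
  by rewrite -[z * x * qi]mulrA xi !mulrA zi.
Qed.

(** Conjugate numbers are identified, so only [Re z / |z|] matters and its [acos] serves as the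
    argument. *)
Lemma polar_csim (R : realType) (z : R[i]) : z != 0 ->
  exists r t, [/\ 0 < r, 0 <= t <= pi & csim z (Complex (r * cos t) (r * sin t))].
Proof.
case: z => a b z0; pose n := sqnormC (Complex a b).
have n0 : 0 < n by rewrite lt_def (sqnormC_ge0 (Complex a b)) sqnormC_eq0 z0.
pose r := Num.sqrt n; have r0 : 0 < r by rewrite sqrtr_gt0.
have rr : r ^+ 2 = n by rewrite sqr_sqrtr ?ltW.
have ar : -1 <= a / r <= 1.
  rewrite ler_pdivlMr // ler_pdivrMr // mulN1r mul1r -ler_norml.
  rewrite -(@ler_pXn2r _ 2) ?nnegrE ?(ltW r0) // rr real_normK ?num_real //.
  by rewrite lerDl sqr_ge0.
have [t0 ct] := acos_def ar; exists r, (acos (a / r)); split=> //.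
split; first by rewrite /= ct mulrC divfK ?lt0r_neq0.
by rewrite -/n -rr /sqnormC /= !exprMn -mulrDr cos2Dsin2 mulr1.
Qed.

(** * Reversibility of the normal forms *)

Lemma reversible_diag3 (R : rcfType) (q q' : quat R) : q * q' = 1 -> q' * q = 1 ->
  reversible (mx3 [:: [:: q; 0; 0]; [:: 0; - q'; 0]; [:: 0; 0; qi]]).
Proof.
move=> qq' q'q.
pose p : 'M[quat R]_3 := mx3 [:: [:: 0; 1; 0]; [:: 1; 0; 0]; [:: 0; 0; 1]].
have pp : p *m p = 1%:M.
  by rewrite mul_mx3 -mx3_1 !(mulr0, mul0r, mulr1, addr0, add0r).
exists p, p; split=> //; rewrite /GRing.mul /= /p !mul_mx3.
rewrite !(mulr0, mul0r, mulr1, addr0, add0r) mulrN mulNr qq' q'q opp_mx3 oppr0.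
by have [-> _ _ _] := quat_units R.
Qed.

Lemma reversible_jordan21 (R : rcfType) :
  reversible (mx3 [:: [:: qi; 1; 0]; [:: 0; qi; 0]; [:: 0; 0; qi]] : 'M[quat R]_3).
Proof.
(* For [M = i + N] with [N^2 = 0], [- M^-1 = i - N]; the sign change turns [N] into [- N]. *)
pose p : 'M[quat R]_3 := mx3 [:: [:: 1; 0; 0]; [:: 0; - 1; 0]; [:: 0; 0; 1]].
have pp : p *m p = 1%:M.
  by rewrite mul_mx3 -mx3_1 !(mulr0, mul0r, mulr1, mul1r, mulrNN, addr0, add0r).
exists p, p; split=> //; rewrite /GRing.mul /= /p !mul_mx3.
rewrite !(mulr0, mul0r, mulr1, mul1r, mulrN, mulNr, addr0, add0r) opp_mx3 oppr0 opprK.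
by have [-> _ _ _] := quat_units R; rewrite opprK addrN.
Qed.

Lemma reversible_jordan3 (R : rcfType) :
  reversible (mx3 [:: [:: qi; 1; 0]; [:: 0; qi; 1]; [:: 0; 0; qi]] : 'M[quat R]_3).
Proof.
(* Now [- M^-1 = i - N - i N^2], and the entry [- qi] produces the term in [N^2]. *)
pose p : 'M[quat R]_3 := mx3 [:: [:: 1; - qi; 0]; [:: 0; - 1; 0]; [:: 0; 0; 1]].
have pp : p *m p = 1%:M.
  rewrite mul_mx3 -mx3_1 !(mulr0, mul0r, mulr1, mul1r, mulrNN, addr0, add0r).
  by rewrite addNr.
exists p, p; split=> //; rewrite /GRing.mul /= /p !mul_mx3 opp_mx3.
by congr (mx3 [:: [:: _; _; _]; [:: _; _; _]; [:: _; _; _]]); congr Quat; ring.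
Qed.

(** * Reduction of a reversible matrix to normal form *)

Lemma diag_mx3 (R : rcfType) (r : 'rV[quat R]_3) :
  diag_mx r = mx3 [:: [:: r 0 0; 0; 0]; [:: 0; r 0 1; 0]; [:: 0; 0; r 0 2]].
Proof. by rewrite [LHS]mx3_eta !mxE. Qed.

Lemma sim_diag3 (R : rcfType) (a b c a' b' c' : quat R) :
  sim a a' -> sim b b' -> sim c c' ->
  sim (mx3 [:: [:: a; 0; 0]; [:: 0; b; 0]; [:: 0; 0; c]])
      (mx3 [:: [:: a'; 0; 0]; [:: 0; b'; 0]; [:: 0; 0; c']]).
Proof.
case=> p1 [q1 [pq1 _ e1]] [p2 [q2 [pq2 _ e2]]] [p3 [q3 [pq3 _ e3]]].
apply: (@sim_mx _ _ (mx3 [:: [:: p1; 0; 0]; [:: 0; p2; 0]; [:: 0; 0; p3]])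
                    (mx3 [:: [:: q1; 0; 0]; [:: 0; q2; 0]; [:: 0; 0; q3]])).
  by rewrite mul_mx3 -mx3_1 !(mulr0, mul0r, addr0, add0r) pq1 pq2 pq3.
by rewrite !mul_mx3 !(mulr0, mul0r, addr0, add0r) e1 e2 e3.
Qed.

Lemma reversible_normal_form (R : realType) (A : 'M[quat R]_3) :
  detH A = 1 -> reversible A ->
  [\/ sim A (mx3 [:: [:: qi; 0; 0]; [:: 0; qi; 0]; [:: 0; 0; qi]]),
      exists r t, [/\ 0 < r, 0 <= t <= pi &
        sim A (mx3 [:: [:: r *: qexpi t; 0; 0]; [:: 0; - (r^-1 *: qexpi (- t)); 0];
                      [:: 0; 0; qi]])],
      sim A (mx3 [:: [:: qi; 1; 0]; [:: 0; qi; 0]; [:: 0; 0; qi]]) |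
      sim A (mx3 [:: [:: qi; 1; 0]; [:: 0; qi; 1]; [:: 0; 0; qi]])].
Proof.
move=> dA revA; have [T [l [AT trT lT charA]]] := triangular_form A.
have [li|[s [l0i l0 l1 l2i]]] := eigenvalue_classes revA dA charA.
  have [||T' [TT' trT' T'i]] := @trig_diag_sim _ _ T (fun=> qi); first exact: trT.
    by move=> i; rewrite lT; apply: (csim_sim (li i)).
  rewrite (trig_lower3 trT') !T'i in TT'.
  have [x [y [z [xi yi zi TT'']]]] := @lower3_reduce _ qi qi qi (T' 1 0) (T' 2 0) (T' 2 1)
    (fun x => x * qi = qi * x) (@commute_qi_solve R) (@commute_qi_solve R)
    (@commute_qi_solve R).
  have AT'' := sim_trans AT (sim_trans TT' TT'').
  have [e|J|J] := nilpotent_normal_form xi yi zi.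
  - by apply: Or41; rewrite e in AT''.
  - by apply: Or43; apply: sim_trans J.
  - by apply: Or44; apply: sim_trans J.
apply: Or42.
(* Pairwise dissimilar eigenvalues make Sylvester's equation solvable at every off-diagonal
   position. *)
have distinct : forall i j, i != j -> ~ csim (l i) (l j).
  have l1i : ~ csim (l (s 1)) (Complex 0 1).
    move=> l1i; apply: l0i; have [] := csim_trans (csim_sym l1) l1i.
    rewrite Re_inv sqnormC_inv /csim [sqnormC (Complex 0 1)]/sqnormC /= => ea en.
    have n1 : sqnormC (l (s 0)) = 1 by rewrite -[LHS]invrK en expr0n expr1n add0r invr1.
    move: ea; rewrite n1 divr1 => /eqP; rewrite oppr_eq0 => /eqP ->.
    by rewrite expr0n expr1n add0r.
  have l01 : ~ csim (l (s 0)) (l (s 1)).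
    by move=> l01; apply: l0i; apply: csim_neg_inv l0 (csim_trans l01 l1).
  have l02 : ~ csim (l (s 0)) (l (s 2)) by move=> h; apply: l0i; apply: csim_trans l2i.
  have l12 : ~ csim (l (s 1)) (l (s 2)) by move=> h; apply: l1i; apply: csim_trans l2i.
  have sE (k : 'I_3) : [\/ k = s 0, k = s 1 | k = s 2].
    have [j ->] : exists j, k = s j by exists (s^-1%g k); rewrite permKV.
    case: j => -[|[|[|//]]] h; [apply: Or31|apply: Or32|apply: Or33];
      by congr (s _); apply: val_inj.
  by move=> i j; case: (sE i) => ->; case: (sE j) => ->; rewrite ?eqxx // => _ // /csim_sym.
have [x [y [z [-> -> -> TT']]]] := @lower3_reduce _ _ _ _ (T 1 0) (T 2 0) (T 2 1)
  (fun x => x = 0)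
  (fun x => sylvester_solve x (distinct 0 1 isT))
  (fun x => sylvester_solve x (distinct 0 2 isT))
  (fun x => sylvester_solve x (distinct 1 2 isT)).
rewrite -!lT -(trig_lower3 trT) in TT'.
have [r [t [r0 t0 lrt]]] := polar_csim l0.
exists r, t; split=> //; apply: sim_trans AT _; apply: sim_trans TT' _.
pose d := \row_i quat_of_complex (l i).
have -> : lower3 (T 0 0) (T 1 1) (T 2 2) 0 0 0 = diag_mx d by rewrite diag_mx3 !mxE !lT.
(* The permutation [s] lists the classes as [l], [- l^-1], [i], the order of the normal form. *)
apply: sim_trans (diag_perm_sim d s) _; rewrite diag_mx3 !mxE.
have r0' := lt0r_neq0 r0.
have e0 : r *: qexpi t = quat_of_complex (Complex (r * cos t) (r * sin t)).
  by congr Quat; ring.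
have e1 : - (r^-1 *: qexpi (- t)) =
    quat_of_complex (- (Complex (r * cos t) (r * sin t))^-1).
  have := cos2Dsin2 t; rewrite /qexpi cosN sinN => cs.
  congr Quat => /=; rewrite ?mulr0 ?oppr0 //.
    by rewrite !exprMn -mulrDr cs mulr1; field.
  by rewrite !exprMn -mulrDr cs mulr1; field.
have csim_inv (u v : R[i]) : csim u v -> csim (- u^-1) (- v^-1).
  by case=> ea en; split; rewrite ?Re_inv ?sqnormC_inv ?ea en.
rewrite e0 e1; apply: sim_diag3; [exact: csim_sim lrt | | exact: (csim_sim l2i)].
exact: csim_sim (csim_trans l1 (csim_inv _ _ lrt)).
Qed.

Theorem lemma4p2 (R : realType) (A : SLH R 3) :
  (exists g : SLH R 3, SLmx (g * A * g^-1)%g = - SLmx (A^-1)%g) <->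
  [\/ exists t : R, (0 <= t <= pi) /\
        SLH_conjugate A (mx3 [:: [:: qexpi t; 0; 0];
                                 [:: 0; - qexpi (- t); 0];
                                 [:: 0; 0; qi]]),
      exists r t : R, [/\ 0 < r, r != 1, 0 <= t <= pi &
        SLH_conjugate A (mx3 [:: [:: r *: qexpi t; 0; 0];
                                 [:: 0; - (r^-1 *: qexpi (- t)); 0];
                                 [:: 0; 0; qi]])],
      SLH_conjugate A (mx3 [:: [:: qi; 1; 0];
                               [:: 0; qi; 0];
                               [:: 0; 0; qi]]) |
      SLH_conjugate A (mx3 [:: [:: qi; 1; 0];
                               [:: 0; qi; 1];
                               [:: 0; 0; qi]])].
Proof.
split=> [/reversibleP revA|].
  have [J|[r [t [r0 t0 J]]]|J|J] := reversible_normal_form (SLH_det A) revA.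
  (* The scalar matrix [qi] is the member of family (i) at the angle [pi / 2], where both [e^(i t)]
     and [- e^(- i t)] equal [i]. *)
  - apply: Or41; exists (pi / 2); split.
      by have := pi_ge0 R; lra.
    apply/SLH_conjugateP; rewrite /qexpi sinN cosN cos_pihalf sin_pihalf.
    by rewrite -[- Quat _ _ _ _]/(Quat _ _ _ _) oppr0 opprK.
  - have [r1|r1] := eqVneq r 1.
      by apply: Or41; exists t; split=> //; apply/SLH_conjugateP;
        rewrite r1 invr1 !scale1r in J.
    by apply: Or42; exists r, t; split=> //; apply/SLH_conjugateP.
  - by apply: Or43; apply/SLH_conjugateP.
  - by apply: Or44; apply/SLH_conjugateP.
have expV t : qexpi t * qexpi (- t) = 1 :> quat R.
  have := cos2Dsin2 t; rewrite /qexpi cosN sinN => cs.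
  by congr Quat; lra.
have expVl t : qexpi (- t) * qexpi t = 1 :> quat R by rewrite -{2}[t]opprK.
have scaleM (a b : R) (x y : quat R) : (a *: x) * (b *: y) = (a * b) *: (x * y).
  by case: x y => [? ? ? ?] [? ? ? ?]; congr Quat => /=; ring.
move=> H; apply/reversibleP; case: H => [[t [_]]|[r [t [r0 _ _]]]||];
  move/SLH_conjugateP/reversible_sim; apply.
- exact: reversible_diag3.
- have r0' := lt0r_neq0 r0; apply: reversible_diag3.
    by rewrite scaleM expV mulfV // scale1r.
  by rewrite scaleM expVl mulVf // scale1r.
- exact: reversible_jordan21.
- exact: reversible_jordan3.
Qed.
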